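(* The semi-discrete moving mesh DG scheme described in the context conserves the mass. That is, if $u(\cdot,\varsigma)\in V_h^r(\varsigma)$, $0<\varsigma\le1$, satisfies \[ \frac{d}{d\varsigma}\int_K uv\,d\bm{x}+\sum_{e\subset\partial K}\int_e vF_e(u_K^{in},u_K^{out})\,ds+\int_K(u\dot{\bm{X}})\cdot\nabla v\,d\bm{x}=0 \] for all elements $K\in\mathcal{T}_h(\varsigma)$ and all test functions $v\in V_h^r(\varsigma)$, then \[ \frac{d}{d\varsigma}\sum_{K\in\mathcal{T}_h(\varsigma)}\int_K u\,d\bm{x}=0 . \]
   Context: Moving mesh. $\mathcal{D}\subset\mathbb{R}^d$ ($d=1,2$) is a bounded polygonal domain. $\mathcal{T}_h^{old}$, $\mathcal{T}_h^{new}$ are simplicial meshes of $\mathcal{D}$ with the same connectivity and vertices $\bm{x}_i^{old}$, $\bm{x}_i^{new}$, $i=1,\dots,N_v$. For $\varsigma\in[0,1]$, $\mathcal{T}_h(\varsigma)$ is the mesh with the same connectivity and vertices $\bm{x}_i(\varsigma)=(1-\varsigma)\bm{x}_i^{old}+\varsigma\bm{x}_i^{new}$; it is assumed to be a nonsingular mesh of $\mathcal{D}$ for all $\varsigma$. The mesh velocity is $\dot{\bm{X}}(\bm{x},\varsigma)=\sum_i(\bm{x}_i^{new}-\bm{x}_i^{old})\phi_i(\bm{x},\varsigma)$, with $\phi_i(\cdot,\varsigma)$ the continuous piecewise linear hat function of vertex $i$ on $\mathcal{T}_h(\varsigma)$. The boundary of the domain does not move: $\dot{\bm{X}}\cdot\bm{n}=0$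 on $\partial\mathcal{D}$. DG space. $V_h^r(\varsigma)=\{v\in L^2(\mathcal{D}): v|_K\in P^r(K)\ \forall K\in\mathcal{T}_h(\varsigma)\}$, $r\ge1$, where $P^r(K)$ is the space of polynomials of degree at most $r$. Test functions move with the mesh: on each element $v=\hat v\circ F_K^{-1}$ with $\hat v\in P^r(\widehat K)$ independent of $\varsigma$, where $F_K:\widehat K\to K$ is the affine map from the reference simplex $\widehat K$. Numerical flux. For an edge (facet) $e\subset\partial K$ with outward unit normal $\bm{n}^e_K$, let $u_K^{in}$ be the trace on $e$ of $u$ from $K$ and $u_K^{out}$ the trace from the neighbor $K'$ across $e$. Then \[F_e(u_K^{in},u_K^{out})=\tfrac12\Big(-(u_K^{in}+u_K^{out})\,\dot{\bm{X}}\cdot\bm{n}^e_K-\alpha_e(u_K^{out}-u_K^{in})\Big),\qquad \alpha_e=\max(|\dot{\bm{X}}\cdot\bm{n}_K^e|,|\dot{\bm{X}}\cdot\bm{n}_{K'}^e|),\] and $F_e=0$ on edges lying on $\partial\mathcal{D}$. *)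

(* Defs.v *)
From HB Require Import structures.
From mathcomp Require Import all_boot all_order all_algebra.
From mathcomp Require Import all_classical all_reals all_analysis.
From mathcomp Require Import -(notations) mpoly.

Set Implicit Arguments.
Unset Strict Implicit.
Unset Printing Implicit Defensive.

Import Order.TTheory GRing.Theory Num.Theory.
Import numFieldNormedType.Exports.

Local Open Scope classical_set_scope.
Local Open Scope ring_scope.

(* Points of R^d are row vectors 'rV[R]_d. The library norm on them is the sup
   norm, so Euclidean lengths and angles are expressed with [dot]. *)
Definition dot (R : realType) (d : nat) (x y : 'rV[R]_d) : R :=
  \sum_(j < d) x 0 j * y 0 j.

Definition grad (R : realType) (d : nat) (v : 'rV[R]_d -> R) (x : 'rV[R]_d)
  : 'rV[R]_d := \row_j 'D_(delta_mx 0 j) v x.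

Definition boundary (T : topologicalType) (D : set T) : set T :=
  closure D `\` interior D.

(* Relative to A: one-sided at an endpoint of A. *)
Definition has_deriv_within (R : realType) (A : set R) (f : R -> R) (t l : R)
  : Prop :=
  (fun s : R => (s - t)^-1 * (f s - f t)) @ within A (t^') --> l.

(* Lebesgue integral over A `<=` R^m, for m <= 2 (Dirac mass if m = 0). Larger m
   do not occur below, and the value 0 given to them has no meaning. *)
Definition vol_int (R : realType) (m : nat)
  : set 'rV[R]_m -> ('rV[R]_m -> R) -> R :=
  match m return set 'rV[R]_m -> ('rV[R]_m -> R) -> R with
  | 0%N => fun A f => \1_A 0 * f 0
  | 1%N => fun A f =>
      let pt := (fun t : R => const_mx t : 'rV[R]_1) in
      \int[@lebesgue_measure R]_(t in pt @^-1` A) f (pt t)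
  | 2%N => fun A f =>
      let pt := (fun z : R * R =>
        row_mx (const_mx z.1 : 'rV[R]_1) (const_mx z.2 : 'rV[R]_1) : 'rV[R]_2) in
      \int[(@lebesgue_measure R \x @lebesgue_measure R)%E]_(z in pt @^-1` A)
        f (pt z)
  | _ => fun _ _ => 0
  end.

(* Vertices are X : 'I_N -> 'rV_d. A simplex is the set S of the indices of its
   vertices, and a mesh connectivity is the set T of its elements. *)
Definition hull (R : realType) (d N : nat) (X : 'I_N -> 'rV[R]_d)
    (S : {set 'I_N}) : set 'rV[R]_d :=
  [set x | exists l : 'I_N -> R,
    [/\ forall i, i \in S -> 0 <= l i, \sum_(i in S) l i = 1
      & x = \sum_(i in S) l i *: X i]].

Definition open_hull (R : realType) (d N : nat) (X : 'I_N -> 'rV[R]_d)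
    (S : {set 'I_N}) : set 'rV[R]_d :=
  [set x | exists l : 'I_N -> R,
    [/\ forall i, i \in S -> 0 < l i, \sum_(i in S) l i = 1
      & x = \sum_(i in S) l i *: X i]].

Definition affine_indep (R : realType) (d N : nat) (X : 'I_N -> 'rV[R]_d)
    (S : {set 'I_N}) : Prop :=
  forall l : 'I_N -> R,
    \sum_(i in S) l i = 0 -> \sum_(i in S) l i *: X i = 0 ->
    forall i, i \in S -> l i = 0.

Definition polygonal_domain (R : realType) (d : nat) (D : set 'rV[R]_d)
  : Prop :=
  [/\ open D, connected D, D !=set0, bounded_set D
    & exists (M : nat) (P : 'I_M -> 'rV[R]_d) (F : {set {set 'I_M}}),
        (forall e, e \in F -> #|e| = d) /\
        boundary D = \bigcup_(e in [set` F]) hull P e].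

(* Nonsingular conforming simplicial mesh of D, with #|K| = d + 1 vertices for
   each element K. Every index is the index of a vertex of some element. *)
Definition is_mesh (R : realType) (d N : nat) (D : set 'rV[R]_d)
    (T : {set {set 'I_N}}) (X : 'I_N -> 'rV[R]_d) : Prop :=
  [/\ finset.cover T = [set: 'I_N]%SET,
      forall K, K \in T ->
        [/\ #|K| = d.+1, affine_indep X K & open_hull X K `<=` D],
      forall K K', K \in T -> K' \in T ->
        hull X K `&` hull X K' = hull X (K :&: K')%SET
    & closure D = \bigcup_(K in [set` T]) hull X K].

Definition mesh_pos (R : realType) (d N : nat) (Xold Xnew : 'I_N -> 'rV[R]_d)
    (s : R) (i : 'I_N) : 'rV[R]_d := (1 - s) *: Xold i + s *: Xnew i.

Definition is_hat_basis (R : realType) (d N : nat) (D : set 'rV[R]_d)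
    (T : {set {set 'I_N}}) (X : 'I_N -> 'rV[R]_d)
    (phi : 'I_N -> 'rV[R]_d -> R) : Prop :=
  forall i,
    [/\ {within closure D, continuous (phi i)},
        forall K, K \in T -> exists (a : 'rV[R]_d) (c : R),
          forall x, hull X K x -> phi i x = dot a x + c
      & forall j, phi i (X j) = (i == j)%:R].

Definition mesh_velocity (R : realType) (d N : nat)
    (Xold Xnew : 'I_N -> 'rV[R]_d) (phi : 'I_N -> 'rV[R]_d -> R)
    (x : 'rV[R]_d) : 'rV[R]_d :=
  \sum_(i < N) phi i x *: (Xnew i - Xold i).

Definition mpoly_fun (R : realType) (d : nat) (p : mpoly d R)
    (x : 'rV[R]_d) : R := meval (fun i => x 0 i) p.

(* mmeasure mdeg p is msize p, the total degree plus one. Elements of V_h^r are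
   classes of functions that are two-valued on interelement facets, hence nothing
   is asked outside the open elements. They are automatically in L^2(D). *)
Definition in_DG (R : realType) (d N : nat) (r : nat) (T : {set {set 'I_N}})
    (X : 'I_N -> 'rV[R]_d) (v : 'rV[R]_d -> R) : Prop :=
  forall K, K \in T -> exists p : mpoly d R,
    (mmeasure mdeg p <= r.+1)%N /\
    forall x, open_hull X K x -> v x = mpoly_fun p x.

Definition ref_simplex (R : realType) (m : nat) : set 'rV[R]_m :=
  [set xi | (forall j, 0 <= xi 0 j) /\ \sum_(j < m) xi 0 j <= 1].

Definition open_ref_simplex (R : realType) (m : nat) : set 'rV[R]_m :=
  [set xi | (forall j, 0 < xi 0 j) /\ \sum_(j < m) xi 0 j < 1].

(* The j-th vertex of S, in increasing order of indices. *)
Definition vtx (R : realType) (d N : nat) (X : 'I_N -> 'rV[R]_d)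
    (S : {set 'I_N}) (j : nat) : 'rV[R]_d := nth 0 [seq X i | i <- enum S] j.

(* The map F_K for S = K and m = d, a parametrization of e for S = e and
   m = d - 1. *)
Definition simplex_map (R : realType) (d N : nat) (X : 'I_N -> 'rV[R]_d)
    (S : {set 'I_N}) (m : nat) (xi : 'rV[R]_m) : 'rV[R]_d :=
  vtx X S 0 + \sum_(j < m) xi 0 j *: (vtx X S j.+1 - vtx X S 0).

Definition moving_test (R : realType) (d N : nat) (r : nat)
    (T : {set {set 'I_N}}) (X : R -> 'I_N -> 'rV[R]_d)
    (v : R -> 'rV[R]_d -> R) : Prop :=
  forall K, K \in T -> exists vhat : mpoly d R,
    (mmeasure mdeg vhat <= r.+1)%N /\
    forall s, 0 <= s <= 1 -> forall xi : 'rV[R]_d, @open_ref_simplex R d xi ->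
      v s (simplex_map (X s) K xi) = mpoly_fun vhat xi.

Definition facets (N : nat) (K : {set 'I_N}) : {set {set 'I_N}} :=
  [set e : {set 'I_N} | (e \subset K) && (#|e|.+1 == #|K|)]%SET.

(* Surface integral: the integral of the pullback times the Gram factor
   sqrt (det (J J^T)), with the edge vectors of e as the rows of J. *)
Definition facet_int (R : realType) (d N : nat) (X : 'I_N -> 'rV[R]_d)
    (e : {set 'I_N}) (g : 'rV[R]_d -> R) : R :=
  let J : 'M[R]_(d.-1, d) := \matrix_(j < d.-1) (vtx X e j.+1 - vtx X e 0) in
  Num.sqrt (\det (J *m J^T)) *
  vol_int (@ref_simplex R d.-1) (fun xi => g (simplex_map X e xi)).

Definition is_outward_normal (R : realType) (d N : nat)
    (X : 'I_N -> 'rV[R]_d) (K e : {set 'I_N}) (n : 'rV[R]_d) : Prop :=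
  [/\ dot n n = 1,
      forall i j, i \in e -> j \in e -> dot n (X i - X j) = 0
    & forall i k, i \in e -> k \in K -> k \notin e -> dot n (X k - X i) < 0].

Definition normal (R : realType) (d N : nat) (X : 'I_N -> 'rV[R]_d)
    (K e : {set 'I_N}) : 'rV[R]_d :=
  xget 0 [set n | is_outward_normal X K e n].

(* The default set0 is for a facet of one element only, which lies on the
   boundary. *)
Definition neighbor (N : nat) (T : {set {set 'I_N}}) (K e : {set 'I_N})
  : {set 'I_N} :=
  odflt finset.set0 [pick K' in T | (K' != K) && (e \subset K')].

Definition trace (R : realType) (d N : nat) (X : 'I_N -> 'rV[R]_d)
    (K : {set 'I_N}) (u : 'rV[R]_d -> R) (x : 'rV[R]_d) : R :=
  lim (u @ within (open_hull X K) (nbhs x)).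

Definition num_flux (R : realType) (d N : nat) (D : set 'rV[R]_d)
    (T : {set {set 'I_N}}) (X : 'I_N -> 'rV[R]_d) (w : 'rV[R]_d -> 'rV[R]_d)
    (u : 'rV[R]_d -> R) (K e : {set 'I_N}) (x : 'rV[R]_d) : R :=
  if `[< hull X e `<=` boundary D >] then 0 else
  let K' := neighbor T K e in
  let wn := dot (w x) (normal X K e) in
  let alpha := Num.max `|wn| `|dot (w x) (normal X K' e)| in
  let uin := trace X K u x in
  let uout := trace X K' u x in
  2^-1 * (- (uin + uout) * wn - alpha * (uout - uin)).

(* The equation of the scheme for an element K and a test function v, at the
   time s. The time derivative is relative to ]0, 1], where u is given. *)
Definition scheme_eq (R : realType) (d N : nat) (D : set 'rV[R]_d)
    (T : {set {set 'I_N}}) (X : R -> 'I_N -> 'rV[R]_d)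
    (w : R -> 'rV[R]_d -> 'rV[R]_d) (u v : R -> 'rV[R]_d -> R) (s : R)
    (K : {set 'I_N}) : Prop :=
  exists dM : R,
    has_deriv_within [set t | 0 < t <= 1]
      (fun t => vol_int (open_hull (X t) K) (fun x => u t x * v t x)) s dM /\
    dM
    + \sum_(e in facets K)
        facet_int (X s) e (fun x =>
          trace (X s) K (v s) x * num_flux D T (X s) (w s) (u s) K e x)
    + vol_int (open_hull (X s) K) (fun x =>
        dot (u s x *: w s x) (grad (v s) x))
    = 0.

(* Main.v *)
(** Testing the scheme with v = 1 on each element leaves the derivative of the
    mass of K and the fluxes through the facets of K. Summed over the mesh, the
    fluxes are regrouped by facet: a facet inside the boundary has zero flux, and
    any other facet is shared by exactly two elements, which lie on opposite sides
    of it, so that their normals are opposite and, the flux being conservative,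
    their contributions cancel. *)

Require Import Defs.
From HB Require Import structures.
From mathcomp Require Import all_boot all_order all_algebra.
From mathcomp Require Import all_classical all_reals all_analysis.
From mathcomp Require Import -(notations) mpoly.
From mathcomp Require Import ring lra.

Set Implicit Arguments.
Unset Strict Implicit.
Unset Printing Implicit Defensive.

Import Order.TTheory GRing.Theory Num.Theory.
Import numFieldNormedType.Exports.

Local Open Scope classical_set_scope.
Local Open Scope ring_scope.

(** * Barycentric coordinates with respect to a set of vertices *)

Lemma sum_subset (N : nat) (V : nmodType) (e K : {set 'I_N}) (F : 'I_N -> V) :
  e \subset K -> \sum_(i in e) F i = \sum_(i in K) (if i \in e then F i else 0).
Proof.
move=> /fintype.subsetP eK; rewrite big_mkcond [RHS]big_mkcond /=.
apply: eq_bigr => i _; case: ifP => [/eK ->//|_]; by case: ifP.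
Qed.

Lemma sum_scale_subset (R : realType) (d N : nat) (X : 'I_N -> 'rV[R]_d)
    (e K : {set 'I_N}) (l : 'I_N -> R) : e \subset K ->
  \sum_(i in e) l i *: X i = \sum_(i in K) (if i \in e then l i else 0) *: X i.
Proof.
move=> eK; rewrite (sum_subset _ eK); apply: eq_bigr => i _.
by case: ifP => // _; rewrite scale0r.
Qed.

Lemma affine_coord_uniq (R : realType) (d N : nat) (X : 'I_N -> 'rV[R]_d)
    (K : {set 'I_N}) (l m : 'I_N -> R) : affine_indep X K ->
  \sum_(i in K) l i = \sum_(i in K) m i ->
  \sum_(i in K) l i *: X i = \sum_(i in K) m i *: X i ->
  forall i, i \in K -> l i = m i.
Proof.
move=> XK lm lmX i iK; apply/eqP; rewrite -subr_eq0; apply/eqP.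
apply: (XK (fun i => l i - m i)) => //.
  by rewrite sumrB lm subrr.
under eq_bigr do rewrite scalerBl.
by rewrite sumrB lmX subrr.
Qed.

(** The matrix with rows [(1, X i)], for [i] in [K], is row free by affine independence. Having
    [d + 1] rows and columns it has full rank, so [(a, w)] lies in its row space. Points are the
    case [a = 1], vectors the case [a = 0]. *)
Lemma affine_coord_exists (R : realType) (d N : nat) (X : 'I_N -> 'rV[R]_d)
    (K : {set 'I_N}) : affine_indep X K -> #|K| = d.+1 ->
  forall (a : R) (w : 'rV[R]_d), exists l : 'I_N -> R,
    \sum_(i in K) l i = a /\ \sum_(i in K) l i *: X i = w.
Proof.
move=> XK cK a w.
(* Coordinates indexed by the enumeration of [K] are carried over to a function on all vertex
   indices. *)
have ext (v : 'rV[R]_#|K|) : exists l : 'I_N -> R,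
    forall j : 'I_#|K|, l (enum_val j) = v 0 j.
  exists (fun i => if [pick j : 'I_#|K| | enum_val j == i] is Some j
                   then v 0 j else 0) => j.
  case: pickP => [j' /eqP/enum_val_inj -> //|/(_ j)]; by rewrite eqxx.
pose A : 'M[R]_(#|K|, 1 + d) := \matrix_j row_mx (const_mx 1) (X (enum_val j)).
have rowA j : row j A = row_mx (const_mx 1) (X (enum_val j)) by rewrite rowK.
have mulA (v : 'rV[R]_#|K|) (l : 'I_N -> R) :
    (forall j, l (enum_val j) = v 0 j) ->
    v *m A = row_mx (const_mx (\sum_(i in K) l i)) (\sum_(i in K) l i *: X i).
  move=> lv; rewrite mulmx_sum_row (big_enum_val l).
  rewrite (big_enum_val (fun i => l i *: X i)).
  under eq_bigr do rewrite rowA scale_row_mx -lv.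
  apply/rowP => k; rewrite summxE -[k]fintype.splitK; case: (fintype.split k) => k' /=.
    rewrite row_mxEl mxE; apply: eq_bigr => j _.
    by rewrite row_mxEl !mxE mulr1.
  rewrite row_mxEr summxE; apply: eq_bigr => j _; by rewrite row_mxEr.
have /eqP rfA : row_free A.
  apply: inj_row_free => v; have [l lv] := ext v; rewrite (mulA v l)//.
  rewrite -(row_mx0 R 1 1 d) => /eq_row_mx[/rowP/(_ 0)]; rewrite !mxE => l0 lX0.
  apply/rowP => j; rewrite mxE -lv; exact: (XK _ l0 lX0 _ (enum_valP j)).
have /submxP[v vA] : (row_mx (const_mx a : 'rV_1) w <= A)%MS.
  by apply: submx_full; rewrite /row_full rfA cK.
have [l lv] := ext v; exists l; move: vA; rewrite (mulA v l)//.
by move=> /eq_row_mx[/rowP/(_ 0)]; rewrite !mxE.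
Qed.

(** * Closed and open hulls, and approach along segments *)

Lemma hull_subset (R : realType) (d N : nat) (X : 'I_N -> 'rV[R]_d)
    (e K : {set 'I_N}) : e \subset K -> hull X e `<=` hull X K.
Proof.
move=> eK x [l [l0 l1 ->]]; exists (fun i => if i \in e then l i else 0).
split; [|by rewrite -sum_subset|exact: sum_scale_subset].
by move=> i _; case: ifP => // /l0.
Qed.

Lemma open_hull_nonempty (R : realType) (d N : nat) (X : 'I_N -> 'rV[R]_d)
    (K : {set 'I_N}) : (0 < #|K|)%N -> open_hull X K !=set0.
Proof.
move=> K0; exists (\sum_(i in K) #|K|%:R^-1 *: X i), (fun=> #|K|%:R^-1).
split => //; first by move=> i _; rewrite invr_gt0 ltr0n.
by rewrite sumr_const -[LHS]mulr_natl mulfV// pnatr_eq0 -lt0n.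
Qed.

Lemma hull_open_segment (R : realType) (d N : nat) (X : 'I_N -> 'rV[R]_d)
    (K : {set 'I_N}) (x b : 'rV[R]_d) (t : R) :
  hull X K x -> open_hull X K b -> 0 < t < 1 ->
  open_hull X K (x + t *: (b - x)).
Proof.
move=> [l [l0 l1 ->]] [m [m0 m1 ->]] /andP[t0 t1].
exists (fun i => (1 - t) * l i + t * m i); split.
- by move=> i iK; rewrite ltr_wpDl ?mulr_ge0 ?mulr_gt0 ?l0 ?m0 ?subr_ge0 ?ltW.
- by rewrite big_split/= -!mulr_sumr l1 m1; ring.
- rewrite -sumrB scaler_sumr -big_split/=; apply: eq_bigr => i _.
  by rewrite -scalerBl scalerA -scalerDl; congr (_ *: _); ring.
Qed.

Lemma cvg_segment (R : realType) (d : nat) (x w : 'rV[R]_d) :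
  x + t *: w @[t --> 0^'+] --> x.
Proof.
suff : x + t *: w @[t --> (0:R)^'+] --> x + (0 : R) *: w by rewrite scale0r addr0.
apply: cvgD; first exact: cvg_cst.
by apply: cvgZr_tmp; apply: cvg_at_right_filter; exact: cvg_id.
Qed.

(** Any point of the hull is approached from inside along the segment toward a point of the open
    hull. *)
Lemma hull_closure (R : realType) (d N : nat) (X : 'I_N -> 'rV[R]_d)
    (K : {set 'I_N}) : (0 < #|K|)%N -> hull X K `<=` closure (open_hull X K).
Proof.
move=> K0 x Kx A Ax; have [b Kb] := open_hull_nonempty X K0.
have nA : \forall t \near 0^'+, A (x + t *: (b - x)).
  exact: (@cvg_segment R d x (b - x) A Ax).
have n1 : \forall t \near (0:R)^'+, 0 < t < 1.
  by near=> t; apply/andP; split.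
have [t [tA t01]] := @filter_ex _ _ _ _ (filterI nA n1).
by exists (x + t *: (b - x)); split => //; exact: hull_open_segment.
Unshelve. all: by end_near. Qed.

(** * Facets and the elements that share them *)

Lemma facet_vertex (N : nat) (K e : {set 'I_N}) : e \in facets K ->
  exists2 k, k \notin e & K = k |: e.
Proof.
rewrite inE => /andP[eK /eqP cK].
have /eqP/cards1P[k Kek] : #|(K :\: e)%SET| = 1%N.
  by rewrite cardsDS// -cK subSnn.
exists k; first by have := set11 k; rewrite -Kek inE => /andP[].
by rewrite -Kek finset.setUC finset.setDE finset.setUIr finset.setUCr finset.setIT;
  apply/esym/finset.setUidPr.
Qed.

Lemma sum_setU1_if (R : realType) (N : nat) (k : 'I_N) (e : {set 'I_N})
    (c : R) (f : 'I_N -> R) : k \notin e ->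
  \sum_(i in k |: e) (if i == k then c else f i) = c + \sum_(i in e) f i.
Proof.
move=> ke; rewrite big_setU1//= eqxx; congr (_ + _); apply: eq_bigr => i ie.
by case: eqP ie ke => // -> ->.
Qed.

Lemma sum_scale_setU1_if (R : realType) (d N : nat) (X : 'I_N -> 'rV[R]_d)
    (k : 'I_N) (e : {set 'I_N}) (c : R) (f : 'I_N -> R) : k \notin e ->
  \sum_(i in k |: e) (if i == k then c else f i) *: X i
  = c *: X k + \sum_(i in e) f i *: X i.
Proof.
move=> ke; rewrite big_setU1//= eqxx; congr (_ + _); apply: eq_bigr => i ie.
by case: eqP ie ke => // -> ->.
Qed.

Lemma hull_setU1 (R : realType) (d N : nat) (X : 'I_N -> 'rV[R]_d)
    (k : 'I_N) (e : {set 'I_N}) (c : R) (f : 'I_N -> R) : k \notin e ->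
  0 <= c -> (forall i, i \in e -> 0 <= f i) -> c + \sum_(i in e) f i = 1 ->
  hull X (k |: e) (c *: X k + \sum_(i in e) f i *: X i).
Proof.
move=> ke c0 f0 cf1; exists (fun i => if i == k then c else f i); split.
- by move=> i; rewrite !inE; case: eqP => //= _ /f0.
- by rewrite sum_setU1_if.
- by rewrite sum_scale_setU1_if.
Qed.

(** The coordinate at [k] tells the side of the hyperplane through [e] on which a point lies; the
    arguments below compare this coordinate alone. *)
Lemma affine_coord_setU1 (R : realType) (d N : nat) (X : 'I_N -> 'rV[R]_d)
    (k : 'I_N) (e : {set 'I_N}) (c c' : R) (f f' : 'I_N -> R) : k \notin e ->
  affine_indep X (k |: e) ->
  c + \sum_(i in e) f i = c' + \sum_(i in e) f' i ->
  c *: X k + \sum_(i in e) f i *: X i = c' *: X k + \sum_(i in e) f' i *: X i ->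
  c = c'.
Proof.
move=> ke Xke cf cfX.
have := @affine_coord_uniq _ _ _ X (k |: e) (fun i => if i == k then c else f i)
  (fun i => if i == k then c' else f' i) Xke.
rewrite !sum_setU1_if// !sum_scale_setU1_if// => /(_ cf cfX k).
by rewrite eqxx; apply; rewrite setU11.
Qed.

Lemma affine_pos_near0 (R : realType) (a b : R) :
  0 < a -> \forall t \near 0^'+, 0 < a + t * b.
Proof.
move=> a0; near=> t.
(* The added 1 keeps the divisor in the bound on [t] positive even if [b] is 0. *)
have b1 : 0 < `|b| + 1 by rewrite ltr_wpDl.
have t0 : 0 < t by [].
have : t * (`|b| + 1) < a.
  by rewrite -ltr_pdivlMr//; near: t; apply: nbhs_right_lt; rewrite divr_gt0.
have : - `|b| <= b by rewrite lerNl -normrN ler_norm.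
move=> /(ler_wpM2l (ltW t0)); lra.
Unshelve. all: by end_near. Qed.

Lemma facet_setI (N : nat) (e : {set 'I_N}) (k k' : 'I_N) :
  k |: e <> k' |: e -> ((k |: e) :&: (k' |: e))%SET = e.
Proof.
move=> neq; apply/setP => i; rewrite !inE.
case: (i \in e); rewrite ?orbT// !orbF.
by apply/negP => /andP[/eqP ik /eqP ik']; apply: neq; rewrite -ik -ik'.
Qed.

(* [c] is the barycentric coordinate at [X k] of the vertex [X k']: if it were
   nonnegative, the two elements would overlap near the barycenter of [e]. *)
Lemma opposite_sides (R : realType) (d N : nat) (D : set 'rV[R]_d)
    (T : {set {set 'I_N}}) (X : 'I_N -> 'rV[R]_d) (e : {set 'I_N})
    (k k' : 'I_N) (c : R) (l : 'I_N -> R) :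
  is_mesh D T X -> (0 < #|e|)%N -> k \notin e -> k' \notin e ->
  k |: e \in T -> k' |: e \in T -> k |: e <> k' |: e ->
  c + \sum_(i in e) l i = 1 ->
  X k' = c *: X k + \sum_(i in e) l i *: X i -> c < 0.
Proof.
move=> [_ simp conf _] e0 ke k'e KT K'T neq cl1 Xk'.
rewrite ltNge; apply/negP => c0.
have m0 : 0 < #|e|%:R^-1 :> R by rewrite invr_gt0 ltr0n.
have sm : \sum_(i in e) #|e|%:R^-1 = 1 :> R.
  by rewrite sumr_const -[LHS]mulr_natl mulfV// pnatr_eq0 -lt0n.
(* These are the coordinates on [e], relative to [k |: e], of the point [y] chosen below. *)
have nl : \forall t \near (0:R)^'+, forall i,
    0 < #|e|%:R^-1 + t * (l i - #|e|%:R^-1).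
  by apply: filter_forall => i; exact: affine_pos_near0.
have n1 : \forall t \near (0:R)^'+, 0 < t < 1.
  by near=> t; apply/andP; split.
have [t [tl /andP[t0 t1]]] := @filter_ex _ _ _ _ (filterI nl n1).
(* A point of the second element, at the fraction [t] of the way from the barycenter of [e] to
   [X k']. *)
pose y := t *: X k' + \sum_(i in e) ((1 - t) * #|e|%:R^-1) *: X i.
have sy : t + \sum_(i in e) (1 - t) * #|e|%:R^-1 = 1.
  by rewrite -mulr_sumr sm; ring.
have yK' : hull X (k' |: e) y.
  apply: hull_setU1 => //; first exact: ltW.
  by move=> i _; rewrite mulr_ge0// ?ltW// subr_gt0.
(* Substituting the expression of [X k'] gives [y] the coordinate [t * c] at [k], nonnegative by the
   assumption to be refuted. *)
have yK : hull X (k |: e) y.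
  have -> : y = (t * c) *: X k + \sum_(i in e)
      (#|e|%:R^-1 + t * (l i - #|e|%:R^-1)) *: X i.
    rewrite /y Xk' scalerDr scalerA -addrA; congr (_ + _).
    rewrite scaler_sumr -big_split/=; apply: eq_bigr => i _.
    by rewrite scalerA -scalerDl; congr (_ *: _); ring.
  apply: hull_setU1 => //; first by rewrite mulr_ge0// ltW.
    by move=> i _; exact/ltW/tl.
  rewrite big_split/= -mulr_sumr sumrB sm.
  by rewrite (_ : \sum_(i in e) l i = 1 - c); [ring|rewrite -cl1; ring].
have : (hull X (k |: e) `&` hull X (k' |: e)) y by [].
(* Conformity puts [y] in the hull of [e], where the coordinate at [k'] is 0 and not [t]. *)
rewrite conf// facet_setI// => -[p [_ p1 yp]].
have [_ K'ind _] := simp _ K'T.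
suff : t = 0 by move=> t00; rewrite t00 ltxx in t0.
apply: (@affine_coord_setU1 _ _ _ X k' e t 0
  (fun=> (1 - t) * #|e|%:R^-1) p k'e K'ind).
  by rewrite sy p1 add0r.
by rewrite -/y yp scale0r add0r.
Unshelve. all: by end_near. Qed.

Lemma affine_coord_exists1 (R : realType) (d N : nat) (X : 'I_N -> 'rV[R]_d)
    (k : 'I_N) (e : {set 'I_N}) : k \notin e ->
  affine_indep X (k |: e) -> #|k |: e| = d.+1 -> forall w : 'rV[R]_d,
  exists (c : R) (l : 'I_N -> R), c + \sum_(i in e) l i = 1 /\
    w = c *: X k + \sum_(i in e) l i *: X i.
Proof.
move=> ke Xke ck w; have [l []] := affine_coord_exists Xke ck 1 w.
by rewrite !big_setU1//= => l1 lw; exists (l k), l.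
Qed.

(** Three distinct elements on [e] would lie pairwise on opposite sides of it. Composing the
    coordinates of [X k'] relative to [K] and of [X k''] relative to [K'] gives [X k''] the
    coordinate [c' * c] at [k], positive as a product of two negatives, whereas it has to be
    negative. *)
Lemma facet_at_most_two (R : realType) (d N : nat) (D : set 'rV[R]_d)
    (T : {set {set 'I_N}}) (X : 'I_N -> 'rV[R]_d) (e K K' K'' : {set 'I_N}) :
  is_mesh D T X -> (0 < #|e|)%N -> K \in T -> K' \in T -> K'' \in T ->
  e \in facets K -> e \in facets K' -> e \in facets K'' ->
  K <> K' -> K' <> K'' -> K = K''.
Proof.
move=> mesh e0 KT K'T K''T eK eK' eK'' KK' K'K''; apply: contrapT => KK''.
have [k ke Kk] := facet_vertex eK; have [k' k'e Kk'] := facet_vertex eK'.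
have [k'' k''e Kk''] := facet_vertex eK''; subst K K' K''.
have [_ simp _ _] := mesh.
have [cK Kind _] := simp _ KT; have [cK' K'ind _] := simp _ K'T.
have [c [l [l1 Xk']]] := affine_coord_exists1 ke Kind cK (X k').
have [c' [l' [l'1 Xk'']]] := affine_coord_exists1 k'e K'ind cK' (X k'').
have c0 := opposite_sides mesh e0 ke k'e KT K'T KK' l1 Xk'.
have c'0 := opposite_sides mesh e0 k'e k''e K'T K''T K'K'' l'1 Xk''.
have : c' * c < 0.
  apply: (@opposite_sides _ _ _ _ _ _ _ k k'' _ (fun i => c' * l i + l' i) mesh
    e0 ke k''e KT K''T KK'').
    by rewrite big_split/= addrA -mulr_sumr -mulrDr l1 mulr1.
  rewrite Xk'' Xk' scalerDr scalerA -addrA; congr (_ + _).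
  rewrite scaler_sumr -big_split/=; apply: eq_bigr => i _.
  by rewrite scalerA -scalerDl.
by rewrite ltNge nmulr_rge0 ?ltW.
Qed.

(** Outside the hull some barycentric coordinate is negative, and it varies affinely along the ray,
    so it stays negative for small [t]. *)
Lemma hull_compl_near (R : realType) (d N : nat) (X : 'I_N -> 'rV[R]_d)
    (K : {set 'I_N}) (y w : 'rV[R]_d) :
  affine_indep X K -> #|K| = d.+1 -> ~ hull X K y ->
  \forall t \near (0:R)^'+, ~ hull X K (y + t *: w).
Proof.
move=> Kind cK yK.
have [m [m1 my]] := affine_coord_exists Kind cK 1 y.
have [n [n0 nw]] := affine_coord_exists Kind cK 0 w.
have [i iK mi] : exists2 i, i \in K & m i < 0.
  apply: contrapT => /forall2NP mi; apply: yK; exists m; split => // i iK.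
  by rewrite leNgt; apply/negP => mi0; case: (mi i).
have : \forall t \near (0:R)^'+, 0 < - m i + t * - n i.
  by apply: affine_pos_near0; rewrite oppr_gt0.
apply: filterS => t tmn [q [q0 q1 qy]].
have : q i = m i + t * n i.
  apply: (@affine_coord_uniq _ _ _ X K q (fun j => m j + t * n j)) => //.
    by rewrite big_split/= -mulr_sumr n0 m1 mulr0 addr0.
  rewrite -qy -my -nw scaler_sumr -big_split/=; apply: eq_bigr => j _.
  by rewrite scalerA -scalerDl.
by have := q0 i iK; lra.
Qed.

(* Cross [e] away from the opposite vertex at a relatively interior point of [e]
   inside [D]: the points just behind [e] lie in some other element. *)
Lemma interior_facet_neighbor (R : realType) (d N : nat) (D : set 'rV[R]_d)
    (T : {set {set 'I_N}}) (X : 'I_N -> 'rV[R]_d) (e K : {set 'I_N}) :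
  is_mesh D T X -> (0 < #|e|)%N -> K \in T -> e \in facets K ->
  ~ hull X e `<=` boundary D ->
  exists K', [/\ K' \in T, K' <> K & e \in facets K'].
Proof.
move=> [_ simp conf cover] e0 KT eK /existsNP[x /not_implyP[xe xD]].
have [k ke Kk] := facet_vertex eK.
have esubK : e \subset K by move: eK; rewrite inE => /andP[].
have [cK Kind _] := simp _ KT.
(* Since the elements cover [closure D], the point [x] belongs to it; not being on the boundary, it
   is interior. *)
have Dx : interior D x.
  apply: contrapT => nDx; apply: xD; split => //.
  by rewrite cover; exists K => //; exact: hull_subset xe.
(* [x] may lie on the relative boundary of [e]; a small move toward [b] makes all its coordinates on
   [e] positive and stays inside [D]. *)
have [b be] := open_hull_nonempty X e0.
have nD : \forall t \near (0:R)^'+, interior D (x + t *: (b - x)).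
  have Dnx : nbhs x (interior D) by exact: (open_nbhs_nbhs (conj (open_interior D) Dx)).
  exact: (@cvg_segment R d x (b - x) (interior D) Dnx).
have n1 : \forall t \near (0:R)^'+, 0 < t < 1.
  by near=> t; apply/andP; split.
have [t [Dy t01]] := @filter_ex _ _ _ _ (filterI nD n1).
have := hull_open_segment xe be t01.
move: (x + _) Dy => y Dy ye.
have [p [p0 p1 yp]] := ye.
(* Following [w] from [y] leads away from [X k], across [e]. *)
pose w := y - X k.
(* There are finitely many elements, so a common small [s] keeps [y + s *: w] out of all those that
   miss [y]. *)
have nh : \forall s \near (0:R)^'+, forall K' : {set 'I_N}, K' \in T ->
    ~ hull X K' y -> ~ hull X K' (y + s *: w).
  apply: filter_forall => K'.
  have [K'T|] := boolP (K' \in T); last by move=> _; apply: filterE.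
  have [yK'|yK'] := pselect (hull X K' y); first by apply: filterE.
  have [cK' K'ind _] := simp _ K'T.
  by apply: filterS (hull_compl_near w K'ind cK' yK') => s.
have nDs : \forall s \near (0:R)^'+, D (y + s *: w).
  exact: (@cvg_segment R d y w D Dy).
have [s [[sh sD] /andP[s0 _]]] := @filter_ex _ _ _ _ (filterI (filterI nh nDs) n1).
have : closure D (y + s *: w) by exact: subset_closure.
rewrite cover => -[K' /= K'T K'ys].
have K'y : hull X K' y by apply: contrapT => /(sh _ K'T).
(* The coordinate of [y + s *: w] at [k] is [- s], so this point is not in [K]. *)
have K'K : K' <> K.
  move=> K'K; move: K'ys; rewrite K'K Kk => -[q [q0 q1 qy]].
  rewrite big_setU1//= in q1; rewrite big_setU1//= in qy; rewrite Kk in Kind.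
  have := q0 k; rewrite setU11 => /(_ isT).
  rewrite (_ : q k = - s); first by lra.
  apply: (@affine_coord_setU1 _ _ _ X k e (q k) (- s) q
    (fun i => (1 + s) * p i)) => //.
    by rewrite q1 -mulr_sumr p1; ring.
  rewrite -qy; under eq_bigr do rewrite -scalerA.
  rewrite -scaler_sumr -yp /w scalerBr scalerDl scale1r scaleNr.
  by rewrite addrA addrC.
have Ky : hull X K y.
  by apply: (hull_subset esubK); exists p; split => // i /p0/ltW.
(* By conformity [y] is a combination of the common vertices. Its coordinates on [e] are positive
   and coordinates are unique, so every vertex of [e] is common. *)
have : (hull X K `&` hull X K') y by [].
rewrite conf// => -[q [q0 q1 yq]].
have KK'K : K :&: K' \subset K by rewrite subsetIl.
have eK' : e \subset K'.
  apply/fintype.subsetP => i ie.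
  have iK : i \in K by apply: (fintype.subsetP esubK).
  have := @affine_coord_uniq _ _ _ X K (fun i => if i \in e then p i else 0)
    (fun i => if i \in K :&: K' then q i else 0) Kind.
  rewrite -!sum_subset// -!sum_scale_subset// p1 q1 -yp -yq.
  move=> /(_ erefl erefl i iK); rewrite ie inE iK /=.
  by case: ifP => // _ pi0; have := p0 i ie; rewrite pi0 ltxx.
exists K'; split => //; rewrite inE eK' /=.
by move: eK; rewrite inE cK => /andP[_]; have [-> _ _] := simp _ K'T.
Unshelve. all: by end_near. Qed.

(** * Scalar products and outward normals *)

Lemma dotDr (R : realType) (d : nat) (x y z : 'rV[R]_d) :
  dot x (y + z) = dot x y + dot x z.
Proof.
by rewrite /dot -big_split/=; apply: eq_bigr => j _; rewrite mxE mulrDr.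
Qed.

Lemma dotZr (R : realType) (d : nat) (a : R) (x y : 'rV[R]_d) :
  dot x (a *: y) = a * dot x y.
Proof.
by rewrite /dot mulr_sumr; apply: eq_bigr => j _; rewrite mxE mulrCA.
Qed.

Lemma dotC (R : realType) (d : nat) (x y : 'rV[R]_d) : dot x y = dot y x.
Proof. by apply: eq_bigr => j _; rewrite mulrC. Qed.

Lemma dotNr (R : realType) (d : nat) (x y : 'rV[R]_d) : dot x (- y) = - dot x y.
Proof. by rewrite -scaleN1r dotZr mulN1r. Qed.

Lemma dotr0 (R : realType) (d : nat) (x : 'rV[R]_d) : dot x 0 = 0.
Proof. by rewrite -(scale0r 0) dotZr mul0r. Qed.

Lemma dot_sumr (R : realType) (d N : nat) (S : {set 'I_N}) (x : 'rV[R]_d)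
    (l : 'I_N -> R) (y : 'I_N -> 'rV[R]_d) :
  dot x (\sum_(i in S) l i *: y i) = \sum_(i in S) l i * dot x (y i).
Proof.
rewrite (big_morph (dot x) (dotDr x) (dotr0 x)).
by apply: eq_bigr => i _; rewrite dotZr.
Qed.

Lemma dot_eq0 (R : realType) (d : nat) (x : 'rV[R]_d) : dot x x = 0 -> x = 0.
Proof.
move=> x0; apply/rowP => j; rewrite mxE.
have := x0; rewrite /dot => /eqP; rewrite psumr_eq0; last first.
  by move=> i _; rewrite -expr2 sqr_ge0.
move=> /allP/(_ j); rewrite mem_index_enum => /(_ isT)/=.
by rewrite mulf_eq0 orbb => /eqP.
Qed.

(** Written with coordinates of sum zero, [w] is a combination of the vectors [X j - X i], hence
    orthogonal to itself. *)
Lemma ortho_edges_eq0 (R : realType) (d N : nat) (X : 'I_N -> 'rV[R]_d)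
    (K : {set 'I_N}) (i : 'I_N) (w : 'rV[R]_d) :
  affine_indep X K -> #|K| = d.+1 ->
  (forall j, j \in K -> dot w (X j - X i) = 0) -> w = 0.
Proof.
move=> Kind cK wK; apply: dot_eq0.
have [l [l0 lw]] := affine_coord_exists Kind cK 0 w.
have {2}-> : w = \sum_(j in K) l j *: (X j - X i).
  under eq_bigr do rewrite scalerBr.
  by rewrite sumrB lw -scaler_suml l0 scale0r subr0.
by rewrite dot_sumr big1// => j jK; rewrite wK// mulr0.
Qed.

(** With [a] and [b] the products of [n] and [n'] with an edge leaving [e], the vector
    [b *: n - a *: n'] is orthogonal to all edges at [X i], hence zero. Unit length gives equal
    squares of [a] and [b], and both are negative. *)
Lemma outward_normal_uniq (R : realType) (d N : nat) (X : 'I_N -> 'rV[R]_d)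
    (K e : {set 'I_N}) (n n' : 'rV[R]_d) :
  affine_indep X K -> #|K| = d.+1 -> (0 < #|e|)%N -> e \in facets K ->
  is_outward_normal X K e n -> is_outward_normal X K e n' -> n = n'.
Proof.
move=> Kind cK /card_gt0P[i ie] eK [n1 ne nk] [n'1 n'e n'k].
have [k ke Kk] := facet_vertex eK.
have kK : k \in K by rewrite Kk setU11.
have := nk i k ie kK ke; have := n'k i k ie kK ke.
set a := dot n _; set b := dot n' _ => b0 a0.
have ab : b *: n - a *: n' = 0.
  apply: (@ortho_edges_eq0 _ _ _ X K i) => // j; rewrite Kk => /setU1P[->|je].
    by rewrite dotC dotDr dotNr !dotZr ![dot (X k - X i) _]dotC -/a -/b; ring.
  by rewrite dotC dotDr dotNr !dotZr ![dot (X j - X i) _]dotC ne// n'e//; ring.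
move/subr0_eq in ab.
have bb : b ^+ 2 = a ^+ 2.
  have := congr1 (fun z => dot z z) ab.
  by rewrite !dotZr ![dot (_ *: _) _]dotC !dotZr n1 n'1 !mulr1 -!expr2.
have ba : b = a by nra.
by apply: (scalerI (a := a)); [rewrite lt_eqF|rewrite -ab ba].
Qed.

(** Modulo edges of [e], which [n] does not see, an edge of [K'] leaving [e] is a negative multiple
    of such an edge of [K]. *)
Lemma outward_normal_opp (R : realType) (d N : nat) (D : set 'rV[R]_d)
    (T : {set {set 'I_N}}) (X : 'I_N -> 'rV[R]_d) (e K K' : {set 'I_N})
    (n : 'rV[R]_d) :
  is_mesh D T X -> (0 < #|e|)%N -> K \in T -> K' \in T ->
  e \in facets K -> e \in facets K' -> K <> K' ->
  is_outward_normal X K e n -> is_outward_normal X K' e (- n).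
Proof.
move=> mesh e0 KT K'T eK eK' KK' [n1 ne nk].
have dotNN z : dot (- n) z = - dot n z by rewrite dotC dotNr dotC.
split; first by rewrite dotNN dotNr opprK.
  by move=> i j ie je; rewrite dotNN ne ?oppr0.
move=> i k'0 ie; rewrite dotNN oppr_lt0.
have [k ke Kk] := facet_vertex eK; have [k' k'e Kk'] := facet_vertex eK'.
rewrite {1}Kk' => /setU1P[->|->//] _; subst K K'.
have [_ simp _ _] := mesh; have [cK Kind _] := simp _ KT.
have [c [l [l1 Xk']]] := affine_coord_exists1 ke Kind cK (X k').
have c0 := opposite_sides mesh e0 ke k'e KT K'T KK' l1 Xk'.
(* Subtracting [X i] is distributed over the coordinates of [X k'], whose sum is 1. *)
have -> : X k' - X i = c *: (X k - X i) + \sum_(j in e) l j *: (X j - X i).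
  rewrite Xk' -{1}[X i]scale1r -l1 scalerDl scaler_suml scalerBr opprD.
  rewrite addrACA -sumrB; congr (_ + _).
  by apply: eq_bigr => j _; rewrite scalerBr.
rewrite dotDr dotZr dot_sumr big1 ?addr0; last first.
  by move=> j je; rewrite ne// mulr0.
by rewrite nmulr_rgt0// nk// setU11.
Qed.

(** Negation exchanges the outward normals of the two elements. If there are any, uniqueness
    identifies the chosen ones; otherwise both choices are the default 0, its own opposite. *)
Lemma normal_opp (R : realType) (d N : nat) (D : set 'rV[R]_d)
    (T : {set {set 'I_N}}) (X : 'I_N -> 'rV[R]_d) (e K K' : {set 'I_N}) :
  is_mesh D T X -> (0 < #|e|)%N -> K \in T -> K' \in T ->
  e \in facets K -> e \in facets K' -> K <> K' ->
  normal X K' e = - normal X K e.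
Proof.
move=> mesh e0 KT K'T eK eK' KK'; have [_ simp _ _] := mesh.
have [[n Kn]|noK] := pselect (exists n, is_outward_normal X K e n).
  have K'n := outward_normal_opp mesh e0 KT K'T eK eK' KK' Kn.
  have [cK Kind _] := simp _ KT; have [cK' K'ind _] := simp _ K'T.
  rewrite /normal; case: xgetP => [n' _ /= K'n'|/(_ (- n))]; last by case.
  case: xgetP => [n'' _ /= Kn''|/(_ n)]; last by case.
  rewrite (outward_normal_uniq K'ind cK' e0 eK' K'n' K'n).
  by rewrite (outward_normal_uniq Kind cK e0 eK Kn'' Kn).
rewrite /normal !xgetPN ?oppr0// => n nN; apply: noK; first by exists n.
exists (- n); apply: (outward_normal_opp mesh e0 K'T KT eK' eK) => //.
exact: nesym.
Qed.

(** * Neighbors and conservativity of the numerical flux *)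

(** [K'] qualifies, so the choice does not fall to the default; any other choice would be a third
    element on [e]. *)
Lemma neighbor_eq (R : realType) (d N : nat) (D : set 'rV[R]_d)
    (T : {set {set 'I_N}}) (X : 'I_N -> 'rV[R]_d) (e K K' : {set 'I_N}) :
  is_mesh D T X -> (0 < #|e|)%N -> K \in T -> K' \in T ->
  e \in facets K -> e \in facets K' -> K <> K' -> neighbor T K e = K'.
Proof.
move=> mesh e0 KT K'T eK eK' KK'; rewrite /neighbor.
have [_ simp _ _] := mesh.
case: pickP => [K1 /and3P[K1T /eqP K1K eK1]|/(_ K')]/=; last first.
  rewrite K'T; move: eK'; rewrite inE => /andP[-> _].
  by have /eqP/negPf -> := nesym KK'.
apply: contrapT => K1K'.
have eK1' : e \in facets K1.
  rewrite inE eK1 /=; move: eK; rewrite inE => /andP[_].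
  by have [-> _ _] := simp _ KT; have [-> _ _] := simp _ K1T.
apply: K1K.
by rewrite (facet_at_most_two mesh e0 K1T K'T KT eK1' eK' eK K1K' (nesym KK')).
Qed.

(** Passing from [K] to [K'] swaps the two traces and negates the normal velocity, while [alpha] is
    unchanged, so the central and the jump term both change sign. *)
Lemma num_flux_opp (R : realType) (d N : nat) (D : set 'rV[R]_d)
    (T : {set {set 'I_N}}) (X : 'I_N -> 'rV[R]_d) (w : 'rV[R]_d -> 'rV[R]_d)
    (u : 'rV[R]_d -> R) (e K K' : {set 'I_N}) (x : 'rV[R]_d) :
  is_mesh D T X -> (0 < #|e|)%N -> K \in T -> K' \in T ->
  e \in facets K -> e \in facets K' -> K <> K' ->
  num_flux D T X w u K' e x = - num_flux D T X w u K e x.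
Proof.
move=> mesh e0 KT K'T eK eK' KK'; rewrite /num_flux.
case: ifP => [_|_]; first by rewrite oppr0.
rewrite (neighbor_eq mesh e0 KT K'T)// (neighbor_eq mesh e0 K'T KT)//; last first.
  exact: nesym.
rewrite (normal_opp mesh e0 KT K'T)// dotNr normrN maxxx.
by ring.
Qed.

(** * Volume integrals, facet integrals and traces *)

(* No integrability is needed: [fine] sends [+oo - +oo] to [0]. *)
Lemma RintegralN (disp : measure_display) (U : measurableType disp)
    (R : realType) (mu : {measure set U -> \bar R}) (A : set U) (f : U -> R) :
  \int[mu]_(x in A) (- f x) = - \int[mu]_(x in A) f x.
Proof.
rewrite /Rintegral integralE [in RHS]integralE.
have fN : (fun x => (- f x)%:E) = (\- (EFin \o f))%E by apply/funext.
rewrite fN funeposN funenegN.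
have : (0 <= \int[mu]_(x in A) ((EFin \o f)^\+)%E x)%E by exact: integral_ge0.
have : (0 <= \int[mu]_(x in A) ((EFin \o f)^\-)%E x)%E by exact: integral_ge0.
by move: (integral _ _ _) (integral _ _ _) => [a||] [b||]//= _ _; rewrite ?oppr0 ?opprB.
Qed.

Lemma vol_intN (R : realType) (m : nat) (A : set 'rV[R]_m) (f : 'rV[R]_m -> R) :
  vol_int A (fun x => - f x) = - vol_int A f.
Proof.
case: m A f => [|[|[|m]]] A f /=; first by rewrite mulrN.
- exact: RintegralN.
- exact: RintegralN.
- by rewrite oppr0.
Qed.

Lemma eq_vol_int (R : realType) (m : nat) (A : set 'rV[R]_m)
    (f g : 'rV[R]_m -> R) :
  (forall x, A x -> f x = g x) -> vol_int A f = vol_int A g.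
Proof.
case: m A f g => [|[|[|m]]] A f g fg //=.
- by rewrite indicE; have [/set_mem/fg ->//|_] := boolP (0 \in A); rewrite !mul0r.
- by apply: eq_Rintegral => t /set_mem/fg.
- by apply: eq_Rintegral => t /set_mem/fg.
Qed.

(** The integral of 0 equals its own opposite, in every dimension at once. *)
Lemma vol_int0 (R : realType) (m : nat) (A : set 'rV[R]_m) :
  vol_int A (fun=> 0) = 0.
Proof.
have := vol_intN A (fun=> 0); rewrite oppr0; lra.
Qed.

Lemma simplex_map_hull (R : realType) (d N m : nat) (X : 'I_N -> 'rV[R]_d)
    (S : {set 'I_N}) (xi : 'rV[R]_m) : #|S| = m.+1 ->
  @ref_simplex R m xi -> hull X S (simplex_map X S xi).
Proof.
move=> cS [xi0 xi1].
have sS : size (enum S) = m.+1 by rewrite -cardE.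
have /card_gt0P[i0 _] : (0 < #|S|)%N by rewrite cS.
(* Barycentric coordinates of the image: [xi] on the vertices after the first, and the complement to
   1 on the first. *)
pose c (j : 'I_m.+1) := if unlift ord0 j is Some j' then xi 0 j'
                        else 1 - \sum_(j < m) xi 0 j.
pose l i := c (inord (index i (enum S))).
have lE (j : 'I_m.+1) : l (nth i0 (enum S) j) = c j.
  by rewrite /l index_uniq ?enum_uniq ?sS// inord_val.
have c0 : c ord0 = 1 - \sum_(j < m) xi 0 j by rewrite /c unlift_none.
have cS' j : c (lift ord0 j) = xi 0 j by rewrite /c liftK.
have sumE (V : nmodType) (F : 'I_N -> V) :
    \sum_(i in S) F i = \sum_(j < m.+1) F (nth i0 (enum S) j).
  by rewrite -big_enum (big_nth i0) sS big_mkord.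
have vE (j : 'I_m.+1) : vtx X S j = X (nth i0 (enum S) j).
  by rewrite /vtx (nth_map i0)// sS.
exists l; split.
- move=> i iS; rewrite /l /c; case: unliftP => [j _|_]; first exact: xi0.
  by rewrite subr_ge0.
- rewrite sumE (eq_bigr c) => [|j _]; last exact: lE.
  rewrite big_ord_recl c0; under [X in _ + X]eq_bigr do rewrite cS'.
  by rewrite subrK.
- rewrite sumE (eq_bigr (fun j => c j *: vtx X S j)) => [|j _]; last by rewrite lE vE.
  rewrite big_ord_recl c0; under [X in _ + X]eq_bigr do rewrite cS'.
  rewrite scalerBl scale1r -addrA; congr (_ + _).
  under [LHS]eq_bigr do rewrite scalerBr.
  by rewrite sumrB addrC scaler_suml.
Qed.

Lemma facet_intN (R : realType) (d N : nat) (X : 'I_N -> 'rV[R]_d)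
    (e : {set 'I_N}) (g : 'rV[R]_d -> R) :
  facet_int X e (fun x => - g x) = - facet_int X e g.
Proof. by rewrite /facet_int vol_intN mulrN. Qed.

Lemma eq_facet_int (R : realType) (d N : nat) (X : 'I_N -> 'rV[R]_d)
    (e : {set 'I_N}) (g h : 'rV[R]_d -> R) : #|e| = d -> (0 < d)%N ->
  (forall x, hull X e x -> g x = h x) -> facet_int X e g = facet_int X e h.
Proof.
move=> ce d0 gh; rewrite /facet_int; congr (_ * _); apply: eq_vol_int => xi hxi.
by apply: gh; apply: simplex_map_hull => //; rewrite ce prednK.
Qed.

(** The limit is meaningful only if the open element accumulates at [x], which makes the filter
    proper; points of the closed element satisfy this. *)
Lemma trace_cst (R : realType) (d N : nat) (X : 'I_N -> 'rV[R]_d)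
    (K : {set 'I_N}) (a : R) (x : 'rV[R]_d) : (0 < #|K|)%N -> hull X K x ->
  trace X K (fun=> a) x = a.
Proof.
move=> K0 /(hull_closure K0) Kx.
have FF := @within_nbhs_proper _ (open_hull X K) x Kx.
exact: lim_cst.
Qed.

(** * Balance of the fluxes and the constant test function *)

Lemma facet_flux_balance (R : realType) (d N : nat) (D : set 'rV[R]_d)
    (T : {set {set 'I_N}}) (X : 'I_N -> 'rV[R]_d) (w : 'rV[R]_d -> 'rV[R]_d)
    (u : 'rV[R]_d -> R) : is_mesh D T X -> (0 < d)%N ->
  \sum_(K in T) \sum_(e in facets K) facet_int X e (num_flux D T X w u K e) = 0.
Proof.
move=> mesh d0; have [_ simp _ _] := mesh.
(* The outer sum now runs over all vertex sets [e], the inner one over the elements having [e] as a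
   facet. *)
rewrite (exchange_big_dep predT)//=; apply: big1 => e _.
have [eD|eD] := pselect (hull X e `<=` boundary D).
  apply: big1 => K _; rewrite /facet_int /num_flux asboolT//.
  by rewrite vol_int0 mulr0.
have [[K [KT eK]]|noK] := pselect (exists K, K \in T /\ e \in facets K); last first.
  by rewrite big_pred0// => K; apply/negP => /andP[KT eK]; apply: noK; exists K.
have e0 : (0 < #|e|)%N.
  move: eK; rewrite inE => /andP[_ /eqP]; have [-> _ _] := simp _ KT.
  by case=> ->.
have [K' [K'T K'K eK']] := interior_facet_neighbor mesh e0 KT eK eD.
(* Only [K] and [K'] contribute: a further element would be a third one on [e]. *)
rewrite (bigD1 K) ?KT//= (bigD1 K')/=; last by rewrite K'T eK'; apply/eqP.
rewrite big1 ?addr0; last first.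
  move=> K1 /andP[/andP[/andP[K1T eK1] /eqP K1K] /eqP K1K']; exfalso; apply: K1K.
  exact: (facet_at_most_two mesh e0 K1T K'T KT eK1 eK' eK K1K' K'K).
have -> : num_flux D T X w u K' e = fun x => - num_flux D T X w u K e x.
  by apply/funext => x; exact: (num_flux_opp _ _ _ mesh e0 KT K'T eK eK' (nesym K'K)).
by rewrite facet_intN subrr.
Qed.

Lemma moving_test_cst (R : realType) (d N r : nat) (T : {set {set 'I_N}})
    (X : R -> 'I_N -> 'rV[R]_d) : moving_test r T X (fun _ _ => 1).
Proof.
move=> K _; exists 1; split; first by rewrite msize1.
by move=> s _ xi _; rewrite /mpoly_fun meval1.
Qed.

Lemma grad_cst (R : realType) (d : nat) (a : R) (x : 'rV[R]_d) :
  grad (fun=> a) x = 0.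
Proof. by apply/rowP => j; rewrite !mxE; exact: derive_cst. Qed.

(** For the test function 1 the gradient term vanishes and the trace on each facet is 1, so the
    scheme gives the derivative of the mass of [K] as minus its total flux. *)
Lemma scheme_eq_one (R : realType) (d N : nat) (D : set 'rV[R]_d)
    (T : {set {set 'I_N}}) (X : R -> 'I_N -> 'rV[R]_d)
    (w : R -> 'rV[R]_d -> 'rV[R]_d) (u : R -> 'rV[R]_d -> R) (s : R)
    (K : {set 'I_N}) : (0 < d)%N -> #|K| = d.+1 ->
  scheme_eq D T X w u (fun _ _ => 1) s K ->
  has_deriv_within [set t | 0 < t <= 1] (fun t => vol_int (open_hull (X t) K) (u t)) s
    (- \sum_(e in facets K)
         facet_int (X s) e (num_flux D T (X s) (w s) (u s) K e)).
Proof.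
move=> d0 cK [dM [hdM]].
have -> : vol_int (open_hull (X s) K)
    (fun x => dot (u s x *: w s x) (grad (fun=> 1) x)) = 0.
  by under eq_fun do rewrite grad_cst dotr0; exact: vol_int0.
rewrite addr0 => /eqP; rewrite addr_eq0 => /eqP dME.
have -> : - \sum_(e in facets K)
    facet_int (X s) e (num_flux D T (X s) (w s) (u s) K e) = dM.
  rewrite dME; congr (- _); apply: eq_bigr => e; rewrite inE cK => /andP[eK /eqP[ce]].
  (* The integrands are compared on the facet only, where the trace of 1 is known. *)
  apply: eq_facet_int => // x ex; rewrite trace_cst ?mul1r ?cK//.
  exact: hull_subset ex.
rewrite (_ : (fun t => _) = (fun t => vol_int (open_hull (X t) K) (fun x => u t x * 1)))//.
by apply/funext => t; under [in RHS]eq_fun do rewrite mulr1.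
Qed.

Lemma has_deriv_within_sum (R : realType) (I : finType) (P : pred I)
    (A : set R) (f : I -> R -> R) (t : R) (l : I -> R) :
  (forall i, P i -> has_deriv_within A (f i) t (l i)) ->
  has_deriv_within A (fun s => \sum_(i | P i) f i s) t (\sum_(i | P i) l i).
Proof.
move=> fl; rewrite /has_deriv_within.
under eq_fun do rewrite -sumrB mulr_sumr.
by apply: cvg_big => [|i Pi]; [exact: add_continuous|exact: fl].
Qed.

Theorem lemma2p2 (R : realType) (d : nat) (hd : d = 1%N \/ d = 2%N)
    (D : set 'rV[R]_d) (hD : polygonal_domain D)
    (N : nat) (T : {set {set 'I_N}}) (Xold Xnew : 'I_N -> 'rV[R]_d)
    (hmesh : forall s : R, 0 <= s <= 1 -> is_mesh D T (mesh_pos Xold Xnew s))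
    (phi : R -> 'I_N -> 'rV[R]_d -> R)
    (hphi : forall s : R, 0 <= s <= 1 ->
      is_hat_basis D T (mesh_pos Xold Xnew s) (phi s))
    (hbdry : forall s : R, 0 <= s <= 1 ->
      forall K e : {set 'I_N}, K \in T -> e \in facets K ->
        hull (mesh_pos Xold Xnew s) e `<=` boundary D ->
      forall x : 'rV[R]_d, hull (mesh_pos Xold Xnew s) e x ->
        dot (mesh_velocity Xold Xnew (phi s) x)
            (normal (mesh_pos Xold Xnew s) K e) = 0)
    (r : nat) (hr : (1 <= r)%N)
    (u : R -> 'rV[R]_d -> R)
    (hu : forall s : R, 0 < s <= 1 ->
      in_DG r T (mesh_pos Xold Xnew s) (u s))
    (hscheme : forall s : R, 0 < s <= 1 ->
      forall K : {set 'I_N}, K \in T ->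
      forall v : R -> 'rV[R]_d -> R,
        moving_test r T (mesh_pos Xold Xnew) v ->
        scheme_eq D T (mesh_pos Xold Xnew)
          (fun t => mesh_velocity Xold Xnew (phi t)) u v s K) :
  forall s : R, 0 < s <= 1 ->
    has_deriv_within [set t | 0 < t <= 1]
      (fun t => \sum_(K in T)
        vol_int (open_hull (mesh_pos Xold Xnew t) K) (u t)) s 0.
Proof.
move=> s s01; have d0 : (0 < d)%N by case: hd => ->.
have s01' : 0 <= s <= 1 by case/andP: s01 => /ltW -> ->.
have mesh := hmesh s s01'; have [_ simp _ _] := mesh.
(* The target 0 is rewritten as minus the sum of all fluxes, to match the derivatives element by
   element. *)
rewrite -[X in has_deriv_within _ _ _ X]oppr0.
rewrite -[X in has_deriv_within _ _ _ (- X)](facet_flux_balance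
  (mesh_velocity Xold Xnew (phi s)) (u s) mesh d0) -sumrN.
apply: has_deriv_within_sum => K KT; have [cK _ _] := simp _ KT.
have v1 := @moving_test_cst R d N r T (mesh_pos Xold Xnew).
exact: (scheme_eq_one d0 cK (hscheme s s01 K KT _ v1)).
Qed.
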